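(* There is a constant $K>0$ such that for $m \ge K(\epsilon^{-1} \mathrm{sd}_\lambda(A,L) + \mathrm{sd}_\lambda(A,L)^2)$ and $S\in\mathbb{R}^{m\times n}$ a sparse embedding matrix (e.g., CountSketch) with $SA$ computable in $O(\mathrm{nnz}(A))$ time, the following two properties hold with constant probability: (I) $\|U_1^\top S^\top S U_1 - U_1^\top U_1\|\le 1/4$, and (II) $\| U_1^\top (S^\top S -I) (b-Ax^* ) \|_2 \le \sqrt{\epsilon\,\mathrm{OPT}/2}$; and with constant probability the corresponding $\widetilde{x} = \arg\min_{x\in\mathbb{R}^d} \|S(Ax-b)\| + \lambda\|Lx\|^2$ is an $\epsilon$-approximate solution to $\min_{x\in\mathbb{R}^d} \|b-Ax\|^2 + \lambda\|Lx\|^2$, i.e. $\|A\widetilde{x}-b\|^2 + \lambda\|L\widetilde{x}\|^2\le (1+\epsilon)\mathrm{OPT}$.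
   Context: Let $A\in\mathbb{R}^{n\times d}$ (with $n\gg d$), $b\in\mathbb{R}^n$, $\lambda\ge 0$, and $L\in\mathbb{R}^{p\times d}$ with $\mathrm{rank}(L)=p$ and $\mathrm{rank}\begin{bmatrix}A\\ L\end{bmatrix}=d$. Let $x^* = \arg\min_{x\in\mathbb{R}^d}\|Ax-b\|^2+\lambda\|Lx\|^2$ and $\mathrm{OPT}=\|Ax^*-b\|^2+\lambda\|Lx^*\|^2$. Let $U_1\in\mathbb{R}^{n\times d}$ denote the first $n$ rows of a matrix with orthonormal columns whose column span equals that of $\begin{bmatrix}A\\ \sqrt{\lambda}L\end{bmatrix}\in\mathbb{R}^{(n+p)\times d}$. The generalized singular value decomposition of $(A,L)$ is $A=U\begin{bmatrix}\Sigma&0\\0&I_{d-p}\end{bmatrix}RQ^\top$, $L=V\begin{bmatrix}\Omega&0\end{bmatrix}RQ^\top$ with $U$ having orthonormal columns, $V,Q$ orthogonal, $R$ upper triangular nonsingular, $\Sigma=\mathrm{diag}(\sigma_1,\ldots,\sigma_p)$, $\Omega=\mathrm{diag}(\mu_1,\ldots,\mu_p)$, $0\le\sigma_1\le\cdots\le\sigma_p<1$, $1\ge\mu_1\ge\cdots\ge\mu_p>0$, $\Sigma^\top\Sigma+\Omega^\top\Omega=I_p$; the generalized singular values are $\gamma_i=\sigma_i/\mu_i$, $i\in[p]$. The statistical dimension for P-splines is $\mathrm{sd}_\lambda(A,L)=\sum_{i=1}^p 1/(1+\lambda/\gamma_i^2)+d-p$ (which equals $\|U_1\|_F^2$ and is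 at most $d$).
   Formalization: In the sketched problem the norm ‖S(Ax−b)‖ is squared (unsquared, the claim fails for A=L=λ=1, b=10); ''SA computable in O(nnz(A)) time'' is expressed only as a bound s·nnz(A) on scalar multiplications, with s nonzeros per column of S. *)

(* Defs.v *)
From HB Require Import structures.
From mathcomp Require Import all_boot all_order all_algebra.
From mathcomp Require Import boolp classical_sets reals.

Set Implicit Arguments.
Unset Strict Implicit.
Unset Printing Implicit Defensive.

Import Order.TTheory GRing.Theory Num.Theory.
Local Open Scope ring_scope.

(* The norm `|_| that the libraries put on matrices is the largest absolute
   value of an entry; the Euclidean and spectral norms are therefore defined
   here. *)
Definition norm2 (R : realType) (n : nat) (x : 'cV[R]_n) : R :=
  Num.sqrt (\sum_i x i 0 ^+ 2).

Definition opnorm (R : realType) (m n : nat) (M : 'M[R]_(m, n)) : R :=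
  sup [set norm2 (M *m x) | x in [set x : 'cV[R]_n | norm2 x <= 1]]%classic.

Definition argmin (R : realType) (T : Type) (f : T -> R) (x : T) : Prop :=
  forall y : T, f x <= f y.

Definition objective (R : realType) (n d p : nat) (A : 'M[R]_(n, d))
    (b : 'cV[R]_n) (lambda : R) (L : 'M[R]_(p, d)) (x : 'cV[R]_d) : R :=
  norm2 (A *m x - b) ^+ 2 + lambda * norm2 (L *m x) ^+ 2.

Definition sketched_objective (R : realType) (m n d p : nat)
    (S : 'M[R]_(m, n)) (A : 'M[R]_(n, d)) (b : 'cV[R]_n) (lambda : R)
    (L : 'M[R]_(p, d)) (x : 'cV[R]_d) : R :=
  norm2 (S *m (A *m x - b)) ^+ 2 + lambda * norm2 (L *m x) ^+ 2.

Definition orthonormal_cols (R : realType) (m n : nat) (U : 'M[R]_(m, n)) :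
  Prop := U^T *m U = 1%:M.

Definition same_colspan (R : realType) (m n k : nat) (U : 'M[R]_(m, n))
  (M : 'M[R]_(m, k)) : Prop := (U^T == M^T)%MS.

(* The d x d block matrix [Sigma, 0; 0, I_(d - p)] (for p <= d), Sigma being
   the diagonal matrix with entries sigma. *)
Definition gsvd_mxA (R : realType) (d p : nat) (sigma : 'I_p -> R) : 'M[R]_d :=
  \matrix_(i < d, j < d)
    if i == j then oapp sigma 1 (insub (val i) : option 'I_p) else 0.

(* The p x d block matrix [Omega, 0] (for p <= d). *)
Definition gsvd_mxL (R : realType) (d p : nat) (mu : 'I_p -> R) : 'M[R]_(p, d) :=
  \matrix_(i < p, j < d) if val i == val j then mu i else 0.

Record is_gsvd (R : realType) (n d p : nat) (A : 'M[R]_(n, d))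
    (L : 'M[R]_(p, d)) (Ug : 'M[R]_(n, d)) (V : 'M[R]_p) (Q T : 'M[R]_d)
    (sigma mu : 'I_p -> R) : Prop := IsGsvd {
  gsvd_A : A = Ug *m gsvd_mxA d sigma *m T *m Q^T ;
  gsvd_L : L = V *m gsvd_mxL d mu *m T *m Q^T ;
  gsvd_U : orthonormal_cols Ug ;
  gsvd_V : orthonormal_cols V ;
  gsvd_Q : orthonormal_cols Q ;
  gsvd_T_upper : forall i j : 'I_d, (j < i)%N -> T i j = 0 ;
  gsvd_T_unit : T \in unitmx ;
  gsvd_sigma_range : forall i, 0 <= sigma i < 1 ;
  gsvd_sigma_incr : forall i j : 'I_p, (i <= j)%N -> sigma i <= sigma j ;
  gsvd_mu_range : forall i, 0 < mu i <= 1 ;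
  gsvd_mu_decr : forall i j : 'I_p, (i <= j)%N -> mu j <= mu i ;
  gsvd_sqr : forall i, sigma i ^+ 2 + mu i ^+ 2 = 1
}.

(* The generalized singular values gamma i may vanish; lambda / 0 then stands
   for +oo and the summand 1 / (1 + lambda / 0) for 0, whereas division by 0
   in the library would make it 1. *)
Definition stat_dim (R : realType) (d p : nat) (lambda : R)
    (gamma : 'I_p -> R) : R :=
  \sum_(i < p) (if gamma i == 0 then 0 else 1 / (1 + lambda / gamma i ^+ 2))
  + (d - p)%:R.

(* Sparse embedding matrices with s nonzero entries per column, as in Nelson
   and Nguyen's definition of oblivious sparse norm-approximating projections.
   The set D of the positions of the nonzero entries is drawn from the law q;
   every column has exactly s of them, and they are negatively correlated.
   The entry at (r, i) \in D is then +1 / sqrt s or -1 / sqrt s, according to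
   an independent fair coin g (r, i).
   For s = 1 this includes CountSketch (countsketch_sparse_embedding below). *)
Record sparse_embedding (R : realType) (m n s : nat)
    (q : {set 'I_m * 'I_n} -> R) : Prop := SparseEmbedding {
  sparse_gt0 : (0 < s)%N ;
  sparse_law_ge0 : forall D, 0 <= q D ;
  sparse_law_sum1 : \sum_D q D = 1 ;
  sparse_col : forall D, q D != 0 ->
    forall i : 'I_n, #|[set r : 'I_m | (r, i) \in D]| = s ;
  sparse_negcor : forall E : {set 'I_m * 'I_n},
    \sum_(D : {set 'I_m * 'I_n} | E \subset D) q D <= (s%:R / m%:R) ^+ #|E|
}.

Definition sparse_mx (R : realType) (m n s : nat) (D : {set 'I_m * 'I_n})
    (g : {ffun 'I_m * 'I_n -> bool}) : 'M[R]_(m, n) :=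
  \matrix_(r < m, i < n)
    if (r, i) \in D then (-1) ^+ g (r, i) / Num.sqrt s%:R else 0.

(* Probability of the event P for the random m x n matrix sparse_mx s D g,
   with D of law q and g uniform, independent of D. *)
Definition sketch_prob (R : realType) (m n s : nat)
    (q : {set 'I_m * 'I_n} -> R) (P : 'M[R]_(m, n) -> Prop) : R :=
  \sum_(D : {set 'I_m * 'I_n})
    q D * (#|[set g : {ffun 'I_m * 'I_n -> bool} | `[< P (sparse_mx R s D g) >]]|%:R
           / #|{ffun 'I_m * 'I_n -> bool}|%:R).

Definition nnz (R : realType) (n d : nat) (A : 'M[R]_(n, d)) : nat :=
  #|[set ij : 'I_n * 'I_d | A ij.1 ij.2 != 0]|.

(* The number of scalar products S r i * A i j with nonzero factors, i.e. of
   multiplications needed to compute S *m A from the nonzero entries. *)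
Definition mul_cost (R : realType) (m n d : nat) (S : 'M[R]_(m, n))
    (A : 'M[R]_(n, d)) : nat :=
  #|[set t : 'I_m * 'I_n * 'I_d | (S t.1.1 t.1.2 != 0) && (A t.1.2 t.2 != 0)]|.

(* CountSketch: a uniformly random h : 'I_n -> 'I_m gives the position h i of
   the only nonzero entry of column i. *)
Definition countsketch_law (R : realType) (m n : nat)
    (D : {set 'I_m * 'I_n}) : R :=
  #|[set h : {ffun 'I_n -> 'I_m} | D == [set (h i, i) | i : 'I_n]]|%:R
  / #|{ffun 'I_n -> 'I_m}|%:R.

Lemma countsketch_law_sum (R : realType) (m n : nat)
    (P : pred {set 'I_m * 'I_n}) :
  \sum_(D | P D) countsketch_law R D =
  #|[set h : {ffun 'I_n -> 'I_m} | P [set (h i, i) | i : 'I_n]]|%:R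
  / #|{ffun 'I_n -> 'I_m}|%:R.
Proof.
rewrite -mulr_suml -natr_sum; congr (_%:R / _).
rewrite -sum1_card (partition_big (fun h : {ffun 'I_n -> 'I_m} =>
  [set (h i, i) | i : 'I_n]) P) /=; last by move=> h; rewrite inE.
apply: eq_bigr => D PD; rewrite -sum1_card; apply: eq_bigl => h; rewrite !inE.
by rewrite eq_sym; case: eqP => [->|]; rewrite ?PD ?andbF.
Qed.

Lemma countsketch_sparse_embedding (R : realType) (m n : nat) :
  (0 < m)%N -> sparse_embedding 1 (@countsketch_law R m n).
Proof.
move=> m_gt0.
have mR : m%:R != 0 :> R by rewrite pnatr_eq0 -lt0n.
split=> //.
- by move=> D; rewrite mulr_ge0 ?invr_ge0.
- rewrite countsketch_law_sum cardsE divff // card_ffun !card_ord.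
  by rewrite natrX expf_neq0.
- move=> D; rewrite mulf_eq0 negb_or pnatr_eq0 cards_eq0 => /andP[+ _] i.
  move=> /set0Pn[h]; rewrite inE => /eqP->.
  rewrite -(cards1 (h i)); apply: eq_card => r; rewrite !inE.
  by apply/imsetP/eqP => [[j _ [-> ->]]|->]; last exists i.
move=> E; rewrite countsketch_law_sum.
rewrite card_ffun !card_ord natrX div1r exprVn.
have [->|[h0]] := set_0Vmem [set h : {ffun 'I_n -> 'I_m} |
    E \subset [set (h i, i) | i : 'I_n]].
  by rewrite cards0 mul0r invr_ge0 exprn_ge0.
rewrite inE => Eh0.
have Eh (h : {ffun 'I_n -> 'I_m}) :
    E \subset [set (h i, i) | i : 'I_n] -> forall e, e \in E -> e.1 = h e.2.
  by move=> /fintype.subsetP hE e /hE /imsetP[i _ ->].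
pose J := [set e.2 | e in E].
have cardJ : #|J| = #|E|.
  apply: card_in_imset => e e' eE e'E ee'.
  by rewrite (surjective_pairing e) (surjective_pairing e')
             (Eh _ Eh0 _ eE) (Eh _ Eh0 _ e'E) ee'.
have le_En : (#|E| <= n)%N by rewrite -cardJ -[leqRHS](card_ord n) max_card.
have le_card : (#|[set h : {ffun 'I_n -> 'I_m} |
    E \subset [set (h i, i) | i : 'I_n]]| <= m ^ (n - #|E|))%N.
  pose F i := if i \in J then pred1 (h0 i) else predT.
  have -> : (m ^ (n - #|E|) = #|family F|)%N.
    rewrite card_family foldrE big_map big_enum /= (bigID (mem J)) /=.
    rewrite big1 ?mul1n => [|i iJ]; last by rewrite /F iJ card1.
    rewrite (eq_bigr (fun=> m)) => [|i /negPf iJ].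
      rewrite prod_nat_const -cardJ; congr (_ ^ _)%N.
      have := cardC (mem J); rewrite [RHS]card_ord => cardJC.
      by apply/eqP; rewrite -(eqn_add2l #|J|) [eqbRHS]cardJC subnKC // cardJ.
    by rewrite /F iJ -[RHS](card_ord m); apply: eq_card.
  apply: subset_leq_card; apply/fintype.subsetP => h; rewrite inE => hE.
  apply/familyP => i; rewrite /F; case: ifP => // /imsetP[e eE ->].
  by rewrite inE -(Eh _ hE _ eE) -(Eh _ Eh0 _ eE).
rewrite ler_pdivrMr ?exprn_gt0 ?ltr0n //.
have -> : m%:R ^+ n = m%:R ^+ (n - #|E|) * m%:R ^+ #|E| :> R.
  by rewrite -exprD subnK.
by rewrite mulrCA mulVf ?expf_neq0 // mulr1 -natrX ler_nat.
Qed.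

(* Main.v *)
Require Import Defs.
From HB Require Import structures.
From mathcomp Require Import all_boot all_order all_algebra.
From mathcomp Require Import boolp classical_sets reals.
From mathcomp Require Import ring lra.

Set Implicit Arguments.
Unset Strict Implicit.
Unset Printing Implicit Defensive.

Import Order.TTheory GRing.Theory Num.Theory.
Local Open Scope ring_scope.

(** Since [U] has orthonormal columns spanning those of [A; sqrt lambda L], the
    squared Frobenius norm of [U1] is the trace of A^T A (A^T A + lambda L^T L)^-1,
    which the GSVD diagonalizes: it equals [sd].

    The columns of [S] have norm 1, so (Sx)^T(Sy) - x^T y has only off-diagonal
    terms, each a product of two distinct random signs.  Such products are
    orthogonal over the signs, and negative correlation of the positions then
    bounds the second moment by (2/m) |x|^2 |y|^2; summing over columns,
    E |X^T S^T S Y - X^T Y|_F^2 <= (2/m) |X|_F^2 |Y|_F^2.  With X = Y = U1, and with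
    X = U1, Y = b - A xstar, Markov's inequality gives (I) and (II).

    Finally write the residual displacement [A; sqrt lambda L] (xt - xstar) as U z.
    Subtracting the normal equations of the two problems in the direction
    xt - xstar gives z^T (I + Delta) z = z^T w, with Delta and w the quantities bounded in
    (I) and (II); hence |z| <= (4/3) |w|, and the excess objective is
    |z|^2 <= (8/9) eps OPT. *)

(** * Inner products, Euclidean and Frobenius norms, and the operator norm *)

Section EuclideanNorm.
Variable R : realType.

Definition dotv n (x y : 'cV[R]_n) : R := \sum_i x i 0 * y i 0.

Definition fro2 m n (M : 'M[R]_(m, n)) : R := \sum_i \sum_j M i j ^+ 2.

Lemma dotvE n (x y : 'cV[R]_n) : dotv x y = (x^T *m y) 0 0.
Proof. by rewrite mxE; apply: eq_bigr => i _; rewrite mxE. Qed.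

Lemma dotvC n (x y : 'cV[R]_n) : dotv x y = dotv y x.
Proof. by apply: eq_bigr => i _; rewrite mulrC. Qed.

Lemma dotvDr n (x y z : 'cV[R]_n) : dotv x (y + z) = dotv x y + dotv x z.
Proof. by rewrite !dotvE mulmxDr mxE. Qed.

Lemma dotvDl n (x y z : 'cV[R]_n) : dotv (y + z) x = dotv y x + dotv z x.
Proof. by rewrite dotvC dotvDr !(dotvC x). Qed.

Lemma dotvZr n a (x y : 'cV[R]_n) : dotv x (a *: y) = a * dotv x y.
Proof. by rewrite !dotvE -scalemxAr mxE. Qed.

Lemma dotvZl n a (x y : 'cV[R]_n) : dotv (a *: x) y = a * dotv x y.
Proof. by rewrite dotvC dotvZr dotvC. Qed.

Lemma dotvNr n (x y : 'cV[R]_n) : dotv x (- y) = - dotv x y.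
Proof. by rewrite -scaleN1r dotvZr mulN1r. Qed.

Lemma dotvBr n (x y z : 'cV[R]_n) : dotv x (y - z) = dotv x y - dotv x z.
Proof. by rewrite !dotvE mulmxBr !mxE. Qed.

Lemma dotv_adj m n (M : 'M[R]_(m, n)) (x : 'cV[R]_n) (y : 'cV[R]_m) :
  dotv (M *m x) y = dotv x (M^T *m y).
Proof. by rewrite !dotvE trmx_mul mulmxA. Qed.

Lemma dotv_ge0 n (x : 'cV[R]_n) : 0 <= dotv x x.
Proof. by apply: sumr_ge0 => i _; rewrite -expr2 sqr_ge0. Qed.

Lemma norm2_ge0 n (x : 'cV[R]_n) : 0 <= norm2 x.
Proof. exact: sqrtr_ge0. Qed.

Lemma norm2_sqr n (x : 'cV[R]_n) : norm2 x ^+ 2 = dotv x x.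
Proof.
rewrite sqr_sqrtr; last by apply: sumr_ge0 => i _; rewrite sqr_ge0.
by apply: eq_bigr => i _; rewrite expr2.
Qed.

Lemma norm2E n (x : 'cV[R]_n) : norm2 x = Num.sqrt (dotv x x).
Proof. by rewrite -norm2_sqr sqrtr_sqr ger0_norm // norm2_ge0. Qed.

Lemma norm2_sqr_fro2 n (x : 'cV[R]_n) : norm2 x ^+ 2 = fro2 x.
Proof.
by rewrite norm2_sqr; apply: eq_bigr => i _; rewrite big_ord1 expr2.
Qed.

Lemma fro2_ge0 m n (M : 'M[R]_(m, n)) : 0 <= fro2 M.
Proof. by do 2!apply: sumr_ge0 => ? _; rewrite sqr_ge0. Qed.

Lemma fro2_le0 m n (M : 'M[R]_(m, n)) : fro2 M <= 0 -> M = 0.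
Proof.
move=> M0; apply/matrixP => i j; rewrite [RHS]mxE; apply/eqP.
rewrite -sqrf_eq0 eq_le sqr_ge0 andbT (le_trans _ M0) //.
rewrite /fro2 (bigD1 i) //= (bigD1 j) //= -addrA lerDl.
apply: addr_ge0; last by do 2!apply: sumr_ge0 => ? _; rewrite sqr_ge0.
by apply: sumr_ge0 => ? _; rewrite sqr_ge0.
Qed.

Lemma fro2_tr m n (M : 'M[R]_(m, n)) : fro2 M = \tr (M^T *m M).
Proof.
rewrite /fro2 exchange_big; apply: eq_bigr => j _; rewrite mxE.
by apply: eq_bigr => i _; rewrite mxE expr2.
Qed.

(* Lagrange's identity. *)
Lemma dotv_sqr_le n (x y : 'cV[R]_n) : dotv x y ^+ 2 <= dotv x x * dotv y y.
Proof.
rewrite -subr_ge0 -(pmulrn_lge0 _ (ltn0Sn 1)).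
have -> : (dotv x x * dotv y y - dotv x y ^+ 2) *+ 2 =
    \sum_i \sum_j (x i 0 * y j 0 - x j 0 * y i 0) ^+ 2.
  transitivity (\sum_i \sum_j (x i 0 * x i 0 * (y j 0 * y j 0)
      + y i 0 * y i 0 * (x j 0 * x j 0)
      - x i 0 * y i 0 * (x j 0 * y j 0) *+ 2)).
    under eq_bigr => i _ do rewrite sumrB big_split /= -!mulr_sumr sumrMnl -mulr_sumr.
    by rewrite sumrB big_split /= sumrMnl -!mulr_suml /dotv; ring.
  by apply: eq_bigr => i _; apply: eq_bigr => j _; ring.
by do 2!apply: sumr_ge0 => ? _; rewrite sqr_ge0.
Qed.

Lemma dotv_le n (x y : 'cV[R]_n) : `|dotv x y| <= norm2 x * norm2 y.
Proof.
rewrite -ler_sqr ?nnegrE ?mulr_ge0 ?norm2_ge0 //.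
by rewrite real_normK ?num_real // exprMn !norm2_sqr dotv_sqr_le.
Qed.

(** Cauchy-Schwarz for each row of [M], then summation over the rows. *)
Lemma norm2_mulmx_le m n (M : 'M[R]_(m, n)) (x : 'cV[R]_n) :
  norm2 (M *m x) <= Num.sqrt (fro2 M) * norm2 x.
Proof.
rewrite -ler_sqr ?nnegrE ?mulr_ge0 ?sqrtr_ge0 ?norm2_ge0 //.
rewrite exprMn !norm2_sqr sqr_sqrtr ?fro2_ge0 // /fro2 mulr_suml.
apply: ler_sum => i _; rewrite -expr2 mxE.
have -> : \sum_j M i j * x j 0 = dotv (row i M)^T x.
  by apply: eq_bigr => j _; rewrite !mxE.
apply: le_trans (dotv_sqr_le _ _) _; rewrite ler_wpM2r ?dotv_ge0 //.
by apply: ler_sum => j _; rewrite !mxE expr2.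
Qed.

Lemma norm2_0 n : norm2 (0 : 'cV[R]_n) = 0.
Proof. by rewrite norm2E /dotv big1 ?sqrtr0 // => i _; rewrite mxE mul0r. Qed.

Lemma norm2Z n a (x : 'cV[R]_n) : norm2 (a *: x) = `|a| * norm2 x.
Proof.
rewrite !norm2E dotvZl dotvZr mulrA -expr2 sqrtrM ?sqr_ge0 //.
by rewrite sqrtr_sqr.
Qed.

(** Second moments are computed for the Frobenius norm; this carries them over to the spectral norm
    in (I). *)
Lemma opnorm_le m n (M : 'M[R]_(m, n)) : opnorm M <= Num.sqrt (fro2 M).
Proof.
apply: ge_sup => [|_ [x /= x1 <-]].
  by exists (norm2 (M *m 0)), 0 => //=; rewrite norm2_0 ler01.
apply: le_trans (norm2_mulmx_le _ _) _.
by rewrite -[leRHS]mulr1 ler_wpM2l ?sqrtr_ge0.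
Qed.

Lemma norm2_le_opnorm m n (M : 'M[R]_(m, n)) (x : 'cV[R]_n) :
  norm2 (M *m x) <= opnorm M * norm2 x.
Proof.
have [x0|] := eqVneq (norm2 x) 0.
  apply: le_trans (norm2_mulmx_le _ _) _.
  by rewrite x0 !mulr0.
rewrite -normr_gt0 (ger0_norm (norm2_ge0 x)) => x0.
have : norm2 (M *m ((norm2 x)^-1 *: x)) <= opnorm M.
  apply: ub_le_sup; last first.
    exists ((norm2 x)^-1 *: x) => //=.
    by rewrite norm2Z ger0_norm ?invr_ge0 ?(ltW x0) // mulVf ?gt_eqF.
  (* [sup] dominates its set only if the set is bounded; the Frobenius norm provides the bound. *)
  exists (Num.sqrt (fro2 M)) => _ [y /= y1 <-].
  apply: le_trans (norm2_mulmx_le _ _) _.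
  by rewrite -[leRHS]mulr1 ler_wpM2l ?sqrtr_ge0.
rewrite -scalemxAr norm2Z ger0_norm ?invr_ge0 ?(ltW x0) //.
by rewrite ler_pdivrMl // mulrC.
Qed.

End EuclideanNorm.

(** * The regularized least squares problem and its sketched version *)

Section Regression.
Variables (R : realType) (n d p : nat) (lambda : R) (L : 'M[R]_(p, d)).
Hypothesis lambda_ge0 : 0 <= lambda.

Implicit Types (k : nat) (x h : 'cV[R]_d).

Definition energy k (A : 'M[R]_(k, d)) h : R :=
  dotv (A *m h) (A *m h) + lambda * dotv (L *m h) (L *m h).

Lemma energy_ge0 k (A : 'M[R]_(k, d)) h : 0 <= energy A h.
Proof. by rewrite addr_ge0 ?mulr_ge0 ?dotv_ge0. Qed.

Lemma objective_ge0 k (A : 'M[R]_(k, d)) (b : 'cV[R]_k) x :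
  0 <= objective A b lambda L x.
Proof.
by apply: addr_ge0; [exact: sqr_ge0 | apply: mulr_ge0 => //; exact: sqr_ge0].
Qed.

(** Half the derivative of the objective at [x] along [h]. The number [k] of rows is free, so that
    sketched data are covered too. *)
Definition gradient k (A : 'M[R]_(k, d)) (b : 'cV[R]_k) x h : R :=
  dotv (A *m h) (A *m x - b) + lambda * dotv (L *m h) (L *m x).

Lemma objectiveD k (A : 'M[R]_(k, d)) (b : 'cV[R]_k) x h :
  objective A b lambda L (x + h) =
  objective A b lambda L x + gradient A b x h *+ 2 + energy A h.
Proof.
rewrite /objective !norm2_sqr !mulmxDr (addrAC _ (A *m h)) /gradient /energy.
move: (A *m x - b) => y; rewrite !(dotvDl, dotvDr).
by rewrite (dotvC y) (dotvC (L *m x) (L *m h)); ring.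
Qed.

(** First-order condition without calculus: a step [t *: h] changes the objective by a quadratic in
    [t], which would be negative for a suitable [t] if the gradient did not vanish. *)
Lemma argmin_gradient k (A : 'M[R]_(k, d)) (b : 'cV[R]_k) x h :
  argmin (objective A b lambda L) x -> gradient A b x h = 0.
Proof.
move=> xmin; set al := gradient _ _ _ _.
have be0 := energy_ge0 A h; set be := energy A h in be0.
(* The exact minimizer would be - al / be, but [be] may be 0; adding 1 still gives a decrease. *)
pose t := - al / (be + 1).
have gradZ : gradient A b x (t *: h) = t * al.
  by rewrite /al /gradient -!scalemxAr !dotvZl; ring.
have energyZ : energy A (t *: h) = t ^+ 2 * be.
  by rewrite /be /energy -!scalemxAr !dotvZl !dotvZr; ring.
have := xmin (x + t *: h); rewrite objectiveD gradZ energyZ -addrA lerDl.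
have be1 : be + 1 != 0 by rewrite gt_eqF // ltr_wpDl.
have -> : (t * al) *+ 2 + t ^+ 2 * be = - (al ^+ 2 * (be + 2) / (be + 1) ^+ 2).
  by rewrite /t; field.
rewrite oppr_ge0 => le0; apply/eqP; rewrite -sqrf_eq0 eq_le sqr_ge0 andbT.
move: le0; rewrite -mulrA pmulr_lle0 // divr_gt0 ?ltr_wpDl //.
by rewrite exprn_gt0 // ltr_wpDl.
Qed.

Lemma objective_argmin (A : 'M[R]_(n, d)) b x y :
  argmin (objective A b lambda L) x ->
  objective A b lambda L y = objective A b lambda L x + energy A (y - x).
Proof.
move=> /argmin_gradient x0.
by rewrite -[in LHS](subrK x y) addrC objectiveD x0 mul0rn addr0.
Qed.

(** The sketched problem is the same kind of regression with data [S *m A] and [S *m b], so its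
    normal equations come from [argmin_gradient] as well. *)
Lemma sketched_objectiveE m (S : 'M[R]_(m, n)) A b :
  sketched_objective S A b lambda L = objective (S *m A) (S *m b) lambda L.
Proof.
by apply/funext => x; rewrite /sketched_objective mulmxBr mulmxA.
Qed.

(** No randomness enters here: (I) and (II) for one fixed [S] already force the approximation
    guarantee. *)
Lemma sketch_approx m (S : 'M[R]_(m, n)) (A : 'M[R]_(n, d)) b
    (U : 'M[R]_(n + p, d)) x xt (eps : R) :
  let U1 := usubmx U in
  let OPT := objective A b lambda L x in
  0 <= eps -> orthonormal_cols U ->
  same_colspan U (col_mx A (Num.sqrt lambda *: L)) ->
  argmin (objective A b lambda L) x ->
  opnorm (U1^T *m S^T *m S *m U1 - U1^T *m U1) <= 1 / 4%:R ->
  norm2 (U1^T *m (S^T *m S - 1%:M) *m (b - A *m x))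
    <= Num.sqrt (eps * OPT / 2%:R) ->
  argmin (sketched_objective S A b lambda L) xt ->
  objective A b lambda L xt <= (1 + eps) * OPT.
Proof.
move=> U1 OPT eps0 Uorth /andP[_ /submxP[Z UZ]] xmin; set De := _ - _ => le1.
set w := _ *m _ => le2; rewrite sketched_objectiveE => xtmin.
have OPT0 : 0 <= OPT := objective_ge0 _ _ _.
(* [z] holds the coordinates of [A; sqrt lambda L] h in the basis [U]; its squared norm is the
   excess objective. *)
pose h := xt - x; pose z := Z^T *m h.
have colE : col_mx A (Num.sqrt lambda *: L) = U *m Z^T.
  by rewrite -[LHS]trmxK UZ trmx_mul trmxK.
have AE : A = U1 *m Z^T by rewrite /U1 mul_usub_mx -colE col_mxKu.
have zE : dotv z z = energy A h.
  have -> : dotv z z = dotv (U *m z) (U *m z).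
    by rewrite dotv_adj mulmxA Uorth mul1mx.
  rewrite /z mulmxA -colE mul_col_mx.
  rewrite /energy /dotv big_split_ord /=; congr (_ + _).
    by apply: eq_bigr => i _; rewrite col_mxEu.
  rewrite mulr_sumr; apply: eq_bigr => i _.
  rewrite col_mxEd -scalemxAl mxE -{3}(sqr_sqrtr lambda_ge0); ring.
have AhE : A *m h = U1 *m z by rewrite AE -mulmxA.
clearbody z.
(* Difference of the two normal equations: [De] records how [S] distorts |A h|^2, and [w] how it
   distorts the product of A h with the residual. *)
have key : dotv z z + dotv z (De *m z) = dotv z w.
  have := argmin_gradient h xmin; have := argmin_gradient h xtmin.
  rewrite /gradient -[xt](subrK x) -/h => e1 e2.
  have {}e1 : dotv (S *m (A *m h)) (S *m (A *m h)) +
      dotv (S *m (A *m h)) (S *m (A *m x - b)) + lambda * (dotv (L *m h) (L *m h)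
        + dotv (L *m h) (L *m x)) = 0.
    by rewrite -[RHS]e1 !mulmxDr !mulmxN !mulmxA !dotvDr; ring.
  have -> : dotv z (De *m z) =
      dotv (S *m (A *m h)) (S *m (A *m h)) - dotv (A *m h) (A *m h).
    by rewrite AhE mulmxBl dotvBr !dotv_adj !mulmxA.
  have -> : dotv z w = - dotv (S *m (A *m h)) (S *m (A *m x - b))
      + dotv (A *m h) (A *m x - b).
    rewrite /w -(opprB (A *m x)); move: (A *m x - b) => y.
    rewrite mulmxN mulmxBr mulmx1 mulmxBl AhE.
    by rewrite !dotv_adj !mulmxA dotvNr dotvBr; ring.
  rewrite zE /energy; move: e1 e2; rewrite !mulrDr; lra.
have z0 := norm2_ge0 z.
(* By (I) the [De] term is at least -|z|^2 / 4, so (3/4) |z|^2 <= |z| |w|; the case |z| = 0 is split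
   off before cancelling. *)
have le3 : norm2 z * 3 <= norm2 w * 4.
  have [->|zn0] := eqVneq (norm2 z) 0.
    by rewrite mul0r mulr_ge0 // norm2_ge0.
  have zp : 0 < norm2 z by rewrite lt_def zn0.
  have h1 : dotv z w <= norm2 z * norm2 w := le_trans (ler_norm _) (dotv_le _ _).
  have h2 : `|dotv z (De *m z)| <= norm2 z * (1 / 4 * norm2 z).
    apply: le_trans (dotv_le _ _) _; rewrite ler_wpM2l //.
    by apply: le_trans (norm2_le_opnorm _ _) _; rewrite ler_wpM2r.
  have {}h2 := lerNnormlW h2.
  rewrite -(ler_pM2l zp); move: key h1 h2; rewrite -norm2_sqr; lra.
rewrite (objective_argmin xt xmin) -/OPT -/h -zE mulrDl mul1r lerD2l.
have le4 : norm2 w ^+ 2 <= eps * OPT / 2.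
  rewrite -(@sqr_sqrtr _ (eps * OPT / 2)) ?divr_ge0 ?mulr_ge0 //.
  by rewrite ler_sqr ?nnegrE ?norm2_ge0 ?sqrtr_ge0.
(* With (II), 9 |z|^2 <= 16 |w|^2 <= 8 eps OPT. *)
have le5 : (norm2 z * 3) ^+ 2 <= (norm2 w * 4) ^+ 2.
  by rewrite ler_sqr ?nnegrE ?mulr_ge0 ?norm2_ge0.
have := mulr_ge0 eps0 OPT0; rewrite -norm2_sqr.
move: le4 le5; rewrite !exprMn; lra.
Qed.

End Regression.

(** * The statistical dimension as a squared Frobenius norm *)

Lemma sum_insub (R : pzRingType) (d p : nat) (F : option 'I_p -> R) :
  (p <= d)%N ->
  \sum_(i < d) F (insub (val i)) = \sum_(i < p) F (Some i) + F None *+ (d - p).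
Proof.
move=> /subnKC; move: (d - p)%N => k <-; rewrite big_split_ord /=.
congr (_ + _); first by apply: eq_bigr => i _; rewrite valK.
by under eq_bigr => i _ do rewrite insubN ?ltnNge ?leq_addr //;
   rewrite sumr_const card_ord.
Qed.

Section StatDim.
Variables (R : realType) (n d p : nat) (A : 'M[R]_(n, d)) (L : 'M[R]_(p, d)).
Variables (Ug : 'M[R]_(n, d)) (V : 'M[R]_p) (Q T : 'M[R]_d) (sigma mu : 'I_p -> R).
Hypothesis gsvdAL : is_gsvd A L Ug V Q T sigma mu.

(** Diagonal entries of the two GSVD blocks; [None] stands for the last d - p indices, where the
    entries are 1 for [A] and 0 for [L]. *)
Let a (o : option 'I_p) := oapp sigma 1 o.
Let l (o : option 'I_p) := oapp mu 0 o.
Let o_ (i : 'I_d) : option 'I_p := insub (val i).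

Lemma gsvd_mxA_gram :
  (gsvd_mxA d sigma)^T *m gsvd_mxA d sigma = diag_mx (\row_i a (o_ i) ^+ 2).
Proof.
apply/matrixP => i j; rewrite !mxE (bigD1 i) //= !mxE eqxx big1 => [|k ki].
  by case: eqP => [->|_]; rewrite ?mulr0 ?addr0 // expr2.
by rewrite !mxE (negPf ki) mul0r.
Qed.

Lemma gsvd_mxL_gram :
  (gsvd_mxL d mu)^T *m gsvd_mxL d mu = diag_mx (\row_i l (o_ i) ^+ 2).
Proof.
apply/matrixP => i j; rewrite !mxE /o_.
case: insubP => [k _ ki|i_p] /=.
  rewrite (bigD1 k) //= !mxE ki eqxx big1 ?addr0 => [|r rk].
    by rewrite -val_eqE /=; case: eqP => _; rewrite ?mulr0 ?expr2.
  rewrite !mxE; case: eqP => [ri|]; last by rewrite mul0r.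
  by case/eqP: rk; apply: val_inj; rewrite /= ki.
rewrite expr0n /= mul0rn big1 // => k _; rewrite !mxE; case: eqP => [ki|].
  by move: i_p; rewrite -ki ltn_ord.
by rewrite mul0r.
Qed.

(** In the coordinates [Y], the Gram matrices of [U1] and [U] are Y^T diag(a^2) Y and Y^T diag(e) Y
    = I, so the trace of the former is the sum of a^2 / e. *)
Lemma fro2_usubmx_stat_dim (lambda : R) (U : 'M[R]_(n + p, d)) :
  0 <= lambda -> (p <= d)%N -> orthonormal_cols U ->
  same_colspan U (col_mx A (Num.sqrt lambda *: L)) ->
  fro2 (usubmx U) = stat_dim d lambda (fun i => sigma i / mu i).
Proof.
case: gsvdAL => AE LE Uo Vo _ _ _ _ _ mu_range _ _.
move=> lambda0 pd Uorth /andP[/submxP[W UW] _].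
have {}UW : U = col_mx A (Num.sqrt lambda *: L) *m W^T.
  by rewrite -[LHS]trmxK UW trmx_mul trmxK.
pose Y := T *m Q^T *m W^T.
have gramA : (A *m W^T)^T *m (A *m W^T) = Y^T *m diag_mx (\row_i a (o_ i) ^+ 2) *m Y.
  rewrite -gsvd_mxA_gram {1 2}AE /Y !trmx_mul !mulmxA.
  by rewrite -[_ *m Ug^T *m Ug]mulmxA Uo mulmx1.
have gramL : (L *m W^T)^T *m (L *m W^T) = Y^T *m diag_mx (\row_i l (o_ i) ^+ 2) *m Y.
  rewrite -gsvd_mxL_gram {1 2}LE /Y !trmx_mul !mulmxA.
  by rewrite -[_ *m V^T *m V]mulmxA Vo mulmx1.
pose e o := a o ^+ 2 + lambda * l o ^+ 2.
have YE : Y^T *m diag_mx (\row_i e (o_ i)) *m Y = 1%:M.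
  rewrite -[RHS]Uorth UW mul_col_mx tr_col_mx mul_row_col gramA.
  rewrite -scalemxAl -scalemxAr [(_ *: _)^T]linearZ /= -scalemxAl scalerA.
  rewrite -expr2 sqr_sqrtr //.
  rewrite gramL scalemxAl scalemxAr -mulmxDl -mulmxDr; congr (_ *m _ *m _).
  by apply/matrixP => i j; rewrite !mxE mulrnAr -mulrnDl.
(* For square matrices a one-sided inverse is two-sided; hence Y Y^T has diagonal 1 / e. *)
have /matrixP YY : Y *m Y^T *m diag_mx (\row_i e (o_ i)) = 1%:M.
  by rewrite -mulmxA; apply: mulmx1C.
have YYe i : (Y *m Y^T) i i * e (o_ i) = 1.
  by have := YY i i; rewrite mul_mx_diag !mxE eqxx.
have -> : usubmx U = A *m W^T by rewrite UW -mul_usub_mx col_mxKu.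
rewrite fro2_tr gramA -mulmxA mxtrace_mulC -mulmxA.
transitivity (\sum_(i < d) a (o_ i) ^+ 2 / e (o_ i)).
  rewrite /mxtrace; apply: eq_bigr => i _.
  rewrite mul_diag_mx mxE [in X in X * _]mxE; congr (_ * _).
  have e0 : e (o_ i) != 0.
    by apply: contra_eq_neq (YYe i) => ->; rewrite mulr0 eq_sym oner_eq0.
  by apply: (mulIf e0); rewrite mulVf // -[RHS](YYe i).
rewrite (sum_insub (fun o => a o ^+ 2 / e o)) // /stat_dim /e /=.
rewrite expr1n expr0n /= mulr0 addr0 divr1; congr (_ + _).
apply: eq_bigr => i _; have /andP[mu0 _] := mu_range i.
rewrite mulf_eq0 invr_eq0 (gt_eqF mu0) orbF.
(* A vanishing sigma contributes 0, in agreement with the convention of [stat_dim]. *)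
case: eqP => [->|/eqP s0]; first by rewrite expr0n mul0r.
have mun0 : mu i != 0 by rewrite gt_eqF.
have s20 : 0 < sigma i ^+ 2 by rewrite lt_def sqrf_eq0 s0 sqr_ge0.
have l20 : 0 <= lambda * mu i ^+ 2 by apply: mulr_ge0 => //; exact: sqr_ge0.
by field; rewrite mun0 s0 gt_eqF // ltr_wpDr.
Qed.

End StatDim.

(** * Orthogonality of products of random signs *)

Section Rademacher.
Variables (R : realType) (I : finType).

(** The Walsh function of [E]. *)
Definition rademacher (E : {set I}) (g : {ffun I -> bool}) : R :=
  \prod_(e in E) (-1) ^+ g e.

(** If E and F differ, some coin [e] lies in exactly one of them, and averaging over that coin alone
    gives 1 - 1 = 0. *)
Lemma rademacher_orthogonal (E F : {set I}) :
  \sum_g rademacher E g * rademacher F g =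
  (E == F)%:R * #|{ffun I -> bool}|%:R.
Proof.
have [->|EF] := eqVneq E F.
  rewrite mul1r -sumr_const; apply: eq_bigr => g _.
  by rewrite -big_split big1 //= => e _; rewrite -signr_addb addbb.
rewrite mul0r.
(* Membership moves into the exponent, so that the product runs over all coins and the sum over [g]
   factorizes. *)
pose f e (b : bool) : R := (-1) ^+ (b && (e \in E)) * (-1) ^+ (b && (e \in F)).
transitivity (\sum_(g : {ffun I -> bool}) \prod_e f e (g e)).
  apply: eq_bigr => g _; rewrite /rademacher (big_mkcond (mem E)).
  rewrite (big_mkcond (mem F)) -big_split; apply: eq_bigr => e _ /=.
  by rewrite /f; case: ifP; case: ifP; rewrite ?andbT ?andbF.
rewrite -bigA_distr_bigA /=.
have [e eEF] : exists e, (e \in E) != (e \in F).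
  apply/existsP; rewrite -negb_forall; apply: contra EF => /forallP EF.
  by apply/eqP/setP => e; apply/eqP.
rewrite (bigD1 e) //= big_bool /f /= !mulr1.
by case: (e \in E) eEF; case: (e \in F); rewrite //= ?mulr1 ?mul1r addNr mul0r.
Qed.

Lemma sum_rademacher_sqr (J : finType) (P : pred J) (E : J -> {set I})
    (a : J -> R) :
  {in P &, injective E} ->
  \sum_g (\sum_(t | P t) a t * rademacher (E t) g) ^+ 2 =
  \sum_(t | P t) a t ^+ 2 * #|{ffun I -> bool}|%:R.
Proof.
move=> Einj.
under eq_bigr => g _.
  rewrite expr2 big_distrlr /=.
  over.
rewrite exchange_big; apply: eq_bigr => t Pt /=.
rewrite exchange_big (bigD1 t) //= [X in _ + X]big1 ?addr0 => [|u /andP[Pu ut]].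
  under eq_bigr => g _ do rewrite mulrACA.
  by rewrite -mulr_sumr rademacher_orthogonal eqxx mul1r expr2.
under eq_bigr => g _ do rewrite mulrACA.
rewrite -mulr_sumr rademacher_orthogonal.
case: eqP => [/Einj tu|]; last by rewrite mul0r mulr0.
by rewrite tu ?eqxx // in ut.
Qed.

End Rademacher.

(** The terms (i, j) and (j, i) carry the same product of signs, so they must be grouped before
    orthogonality applies. *)
Lemma sum_upper_triangle (V : nmodType) n (h : 'I_n -> 'I_n -> V) :
  \sum_(i < n) \sum_(j < n) h i j =
  \sum_(i < n) h i i + \sum_(i < n) \sum_(j < n | (i < j)%N) (h i j + h j i).
Proof.
have -> : \sum_(i < n) \sum_(j < n | (i < j)%N) (h i j + h j i) =
    \sum_(i < n) (\sum_(j < n | (i < j)%N) h i j + \sum_(j < n | (j < i)%N) h i j).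
  under eq_bigr do rewrite big_split.
  rewrite !big_split /=; congr (_ + _).
  by rewrite (exchange_big_dep predT).
rewrite -big_split; apply: eq_bigr => i _ /=.
rewrite (bigD1 i) //= (bigID (fun j : 'I_n => (i < j)%N)) /=.
congr (_ + (_ + _)); apply: eq_bigl => j; rewrite -val_eqE /=; by case: ltngtP.
Qed.

(** * Moments of the sparse embedding *)

Section Sketch.
Variables (R : realType) (m n s : nat) (q : {set 'I_m * 'I_n} -> R).
Hypothesis q_sparse : sparse_embedding s q.

Definition sketch_mean (f : 'M[R]_(m, n) -> R) : R :=
  \sum_D q D * ((\sum_g f (sparse_mx R s D g))
                / #|{ffun 'I_m * 'I_n -> bool}|%:R).

Let N_gt0 : 0 < #|{ffun 'I_m * 'I_n -> bool}|%:R :> R.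
Proof. by rewrite ltr0n card_ffun card_bool expn_gt0. Qed.

Lemma sketch_meanD f h :
  sketch_mean (fun S => f S + h S) = sketch_mean f + sketch_mean h.
Proof.
rewrite -big_split; apply: eq_bigr => D _ /=.
by rewrite big_split mulrDl mulrDr.
Qed.

Lemma sketch_meanZ a f : sketch_mean (fun S => a * f S) = a * sketch_mean f.
Proof.
rewrite mulr_sumr; apply: eq_bigr => D _ /=.
by rewrite -mulr_sumr -mulrA mulrCA.
Qed.

Lemma sketch_mean_sum (I : finType) (f : I -> 'M[R]_(m, n) -> R) :
  sketch_mean (fun S => \sum_i f i S) = \sum_i sketch_mean (f i).
Proof.
rewrite exchange_big; apply: eq_bigr => D _ /=.
by rewrite exchange_big mulr_suml mulr_sumr.
Qed.

Lemma sketch_prob_le (P P' : 'M[R]_(m, n) -> Prop) :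
  (forall S, P S -> P' S) -> sketch_prob s q P <= sketch_prob s q P'.
Proof.
move=> PP'; apply: ler_sum => D _; rewrite ler_wpM2l ?(sparse_law_ge0 q_sparse) //.
rewrite ler_pM2r ?invr_gt0 // ler_nat subset_leq_card //.
apply/fintype.subsetP => g; rewrite !inE; 
exact: PP'.
Qed.

(** [f] dominates the indicator of failure of [P]. *)
Lemma sketch_prob_markov (P : 'M[R]_(m, n) -> Prop) (f : 'M[R]_(m, n) -> R) :
  (forall S, 0 <= f S) -> (forall S, ~ P S -> 1 <= f S) ->
  1 - sketch_mean f <= sketch_prob s q P.
Proof.
move=> f0 f1; rewrite lerBlDr -(sparse_law_sum1 q_sparse) -big_split.
apply: ler_sum => D _ /=; rewrite -mulrDr -mulrDl -[leLHS]mulr1.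
rewrite ler_wpM2l ?(sparse_law_ge0 q_sparse) // ler_pdivlMr // mul1r.
rewrite -sum1_card -[in leRHS]sum1_card !natr_sum [in leRHS]big_mkcond -big_split.
apply: ler_sum => g _ /=; rewrite inE.
case: asboolP => [_|/f1]; first by rewrite lerDl.
by rewrite add0r.
Qed.

Lemma sparse_mx_sqr_sum D g i : q D != 0 ->
  \sum_r sparse_mx R s D g r i ^+ 2 = 1.
Proof.
move=> qD; have s0 : s%:R != 0 :> R.
  by rewrite pnatr_eq0 -lt0n (sparse_gt0 q_sparse).
under eq_bigr => r _.
  rewrite mxE (_ : _ ^+ 2 = if (r, i) \in D then s%:R^-1 else 0); last first.
    case: ifP => _; last by rewrite expr0n.
    by rewrite expr_div_n sqr_sqrtr ?ler0n // sqrr_sign div1r.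
  over.
rewrite -big_mkcond sumr_const -[LHS]mulr_natr.
by have := sparse_col q_sparse qD i; rewrite cardsE => ->; rewrite mulVf.
Qed.

(** A triple (r, (i, j)) stands for the product of the entries of row r in columns i and j.
    Requiring i < j makes [pos] injective. *)
Let pos (t : 'I_m * ('I_n * 'I_n)) : {set 'I_m * 'I_n} :=
  [set (t.1, t.2.1); (t.1, t.2.2)].

Let upper (t : 'I_m * ('I_n * 'I_n)) : bool := (t.2.1 < t.2.2)%N.

Let coef (x y : 'cV[R]_n) (t : 'I_m * ('I_n * 'I_n)) : R :=
  x t.2.1 0 * y t.2.2 0 + x t.2.2 0 * y t.2.1 0.

Lemma sum_upper (f : 'I_m -> 'I_n -> 'I_n -> R) :
  \sum_(r < m) \sum_(i < n) \sum_(j < n | (i < j)%N) f r i j =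
  \sum_(t | upper t) f t.1 t.2.1 t.2.2.
Proof.
rewrite (eq_bigr (fun r : 'I_m =>
  \sum_(ij : 'I_n * 'I_n | (ij.1 < ij.2)%N) f r ij.1 ij.2)).
  by rewrite pair_big_dep.
by move=> r _; rewrite pair_big_dep.
Qed.

(** The diagonal terms add up to x^T y since columns have norm 1; for fixed [D] the rest is a
    combination of distinct Walsh functions of the signs. *)
Lemma sketch_dotvB D g (x y : 'cV[R]_n) : q D != 0 ->
  let S := sparse_mx R s D g in
  dotv (S *m x) (S *m y) - dotv x y =
  \sum_(t | upper t)
     (if pos t \subset D then coef x y t / s%:R else 0) * rademacher R (pos t) g.
Proof.
move=> qD S; apply/eqP; rewrite subr_eq addrC; apply/eqP.
rewrite /dotv.
transitivity (\sum_r \sum_i \sum_j S r i * S r j * (x i 0 * y j 0)).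
  apply: eq_bigr => r _; rewrite !mxE big_distrlr /=.
  by apply: eq_bigr => i _; apply: eq_bigr => j _; rewrite mulrACA.
under eq_bigr do rewrite sum_upper_triangle.
rewrite big_split /=; congr (_ + _).
  rewrite exchange_big; apply: eq_bigr => i _ /=.
  under eq_bigr do rewrite -expr2.
  by rewrite -mulr_suml sparse_mx_sqr_sum // mul1r.
rewrite sum_upper; apply: eq_bigr => -[r [i j]] /= ij.
rewrite /upper /= in ij.
rewrite /pos finset.subUset !finset.sub1set /coef /rademacher /= !mxE.
rewrite big_setU1 ?big_set1 /=; last first.
  by rewrite inE; apply/eqP => -[ijE]; rewrite ijE ltnn in ij.
case: ifP => _; case: ifP => _ /=; rewrite ?(mul0r, mulr0, addr0) //.
rewrite -[in RHS](sqr_sqrtr (ler0n R s)) expr2 invfM; ring.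
Qed.

Lemma pos_inj : {in upper &, injective pos}.
Proof.
move=> [r [i j]] [r' [i' j']]; rewrite !unfold_in /upper /pos /= => ij ij' /setP E.
have := E (r, i); have := E (r, j).
rewrite !inE !xpair_eqE !eqxx /= orbT -!val_eqE /=.
move=> /esym /orP[] /andP[/eqP rr /eqP jj] /esym /orP[] /andP[_ /eqP ii].
- by rewrite ii jj ltnn in ij.
- by rewrite ii jj ltnNge (ltnW ij') in ij.
- by rewrite (val_inj rr) (val_inj ii) (val_inj jj).
- by rewrite ii jj ltnn in ij.
Qed.

Lemma sketch_mean_dotvB (x y : 'cV[R]_n) :
  sketch_mean (fun S => (dotv (S *m x) (S *m y) - dotv x y) ^+ 2) <=
  2 / m%:R * (dotv x x * dotv y y).
Proof.
have s0 : s%:R != 0 :> R.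
  by rewrite pnatr_eq0 -lt0n (sparse_gt0 q_sparse).
(* Averaging over the signs removes the cross terms; averaging over [D] then leaves the probability
   that both positions are occupied. *)
have -> : sketch_mean (fun S => (dotv (S *m x) (S *m y) - dotv x y) ^+ 2) =
    \sum_(t | upper t) (coef x y t / s%:R) ^+ 2
       * \sum_(D : {set 'I_m * 'I_n} | pos t \subset D) q D.
  transitivity (\sum_D q D * \sum_(t | upper t)
      (if pos t \subset D then coef x y t / s%:R else 0) ^+ 2).
    apply: eq_bigr => D _; have [->|qD] := eqVneq (q D) 0; first by rewrite !mul0r.
    under eq_bigr do rewrite sketch_dotvB //.
    rewrite sum_rademacher_sqr; last exact: pos_inj.
    by rewrite -mulr_suml mulfK // gt_eqF.
  under eq_bigr do rewrite mulr_sumr.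
  rewrite exchange_big; apply: eq_bigr => t _ /=.
  rewrite mulr_sumr [RHS]big_mkcond; apply: eq_bigr => D _.
  by case: ifP => _; rewrite ?expr0n ?mulr0 // mulrC.
(* Negative correlation bounds that probability by (s/m)^2, and s cancels. *)
apply: (@le_trans _ _ (\sum_(t | upper t) coef x y t ^+ 2 / m%:R ^+ 2)).
  apply: ler_sum => -[r [i j]] ij.
  have := sparse_negcor q_sparse (pos (r, (i, j))).
  have -> : #|pos (r, (i, j))| = 2%N.
    rewrite cards2 xpair_eqE eqxx /=; case: eqP => // ijE.
    by rewrite /upper /= ijE ltnn in ij.
  move=> /(ler_wpM2l (sqr_ge0 (coef x y (r, (i, j)) / s%:R))) /le_trans; apply.
  by rewrite -exprMn mulrA divfK // exprMn exprVn.
rewrite -(sum_upper (fun r i j => (x i 0 * y j 0 + x j 0 * y i 0) ^+ 2 / m%:R ^+ 2)).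
rewrite sumr_const card_ord.
(* (u + v)^2 <= 2 (u^2 + v^2), after discarding the nonnegative diagonal. The m equal rows turn
   1/m^2 into 1/m. *)
have le2 : \sum_(i < n) \sum_(j < n | (i < j)%N) (x i 0 * y j 0 + x j 0 * y i 0) ^+ 2 <=
    2 * (dotv x x * dotv y y).
  pose h i j := x i 0 ^+ 2 * y j 0 ^+ 2.
  have -> : dotv x x * dotv y y = \sum_i \sum_j h i j.
    by rewrite /dotv big_distrlr /=; apply: eq_bigr => i _; apply: eq_bigr => j _.
  rewrite sum_upper_triangle mulrDr.
  apply: ler_wpDl; first by rewrite mulr_ge0 // sumr_ge0 // => i _; rewrite mulr_ge0 ?sqr_ge0.
  rewrite mulr_sumr; apply: ler_sum => i _; rewrite mulr_sumr; apply: ler_sum => j _.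
  rewrite -subr_ge0.
  have -> : 2 * (h i j + h j i) - (x i 0 * y j 0 + x j 0 * y i 0) ^+ 2 =
    (x i 0 * y j 0 - x j 0 * y i 0) ^+ 2 by rewrite /h; ring.
  exact: sqr_ge0.
under eq_bigr do rewrite -mulr_suml.
rewrite -mulr_suml -[leLHS]mulr_natr.
have [->|m0] := eqVneq (m%:R : R) 0.
  by rewrite mulr0 invr0 mulr0 mul0r.
by rewrite -mulrA expr2 invfM divfK // mulrAC ler_wpM2r // invr_ge0 ler0n.
Qed.

(** Each entry of the error matrix is the error for one pair of columns of [X] and [Y]. *)
Lemma sketch_mean_mulmx k l (X : 'M[R]_(n, k)) (Y : 'M[R]_(n, l)) :
  sketch_mean (fun S => fro2 (X^T *m S^T *m S *m Y - X^T *m Y)) <=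
  2 / m%:R * (fro2 X * fro2 Y).
Proof.
have -> : (fun S : 'M[R]_(m, n) => fro2 (X^T *m S^T *m S *m Y - X^T *m Y)) =
    (fun S => \sum_i \sum_j
      (dotv (S *m col i X) (S *m col j Y) - dotv (col i X) (col j Y)) ^+ 2).
  apply/funext => S; apply: eq_bigr => i _; apply: eq_bigr => j _.
  rewrite -trmx_mul -mulmxA !mxE; congr ((_ - _) ^+ 2); apply: eq_bigr => r _.
    by rewrite !mxE; congr (_ * _); apply: eq_bigr => h _; rewrite mxE.
  by rewrite !mxE.
rewrite sketch_mean_sum.
have fro2_col a (Z : 'M[R]_(n, a)) : fro2 Z = \sum_i dotv (col i Z) (col i Z).
  rewrite /fro2 exchange_big; apply: eq_bigr => i _; apply: eq_bigr => r _.
  by rewrite !mxE expr2.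
rewrite !fro2_col big_distrlr mulr_sumr; apply: ler_sum => i _ /=.
rewrite sketch_mean_sum mulr_sumr; apply: ler_sum => j _.
exact: sketch_mean_dotvB.
Qed.

(** A nonzero entry A i j meets only the s nonzero entries in column i of [S]. *)
Lemma mul_cost_le d (A : 'M[R]_(n, d)) D g : q D != 0 ->
  (mul_cost (sparse_mx R s D g) A <= s * nnz A)%N.
Proof.
move=> qD.
rewrite /mul_cost -sum1_card.
rewrite (partition_big (fun t : 'I_m * 'I_n * 'I_d => (t.1.2, t.2))
  (mem [set ij : 'I_n * 'I_d | A ij.1 ij.2 != 0])) /=; last first.
  by move=> t; rewrite !inE => /andP[].
rewrite mulnC -sum_nat_const; apply: leq_sum => -[i j] _.
rewrite sum1_card -(sparse_col q_sparse qD i).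
rewrite -(card_imset _ (_ : injective (fun r : 'I_m => (r, i, j)))); last first.
  by move=> r r' [].
apply/subset_leq_card/fintype.subsetP => -[[r k] l].
rewrite unfold_in !inE /= mxE => /andP[/andP[S0 _] /eqP[ki ->]]; move: S0; rewrite ki.
rewrite mem_imset ?inE; last by move=> ? ? [].
by case: ifP; rewrite ?eqxx.
Qed.

End Sketch.

(** * Choice of the constant and the probability bounds *)

Theorem mainTheorem5 (R : realType) (delta : R) (delta01 : 0 < delta < 1) :
  exists2 K : R, 0 < K &
  forall (n d p : nat) (A : 'M[R]_(n, d)) (b : 'cV[R]_n) (lambda : R)
    (L : 'M[R]_(p, d)) (xstar : 'cV[R]_d) (U : 'M[R]_(n + p, d))
    (Ug : 'M[R]_(n, d)) (V : 'M[R]_p) (Q T : 'M[R]_d) (sigma mu : 'I_p -> R)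
    (eps : R) (m s : nat) (q : {set 'I_m * 'I_n} -> R),
  let U1 := usubmx U in
  let OPT := objective A b lambda L xstar in
  let sd := stat_dim d lambda (fun i => sigma i / mu i) in
  0 <= lambda ->
  \rank L = p ->
  \rank (col_mx A L) = d ->
  argmin (objective A b lambda L) xstar ->
  orthonormal_cols U ->
  same_colspan U (col_mx A (Num.sqrt lambda *: L)) ->
  is_gsvd A L Ug V Q T sigma mu ->
  0 < eps ->
  sparse_embedding s q ->
  K * (eps^-1 * sd + sd ^+ 2) <= m%:R ->
  [/\ forall (D : {set 'I_m * 'I_n}) (g : {ffun 'I_m * 'I_n -> bool}),
        q D != 0 -> (mul_cost (sparse_mx R s D g) A <= s * nnz A)%N,
      1 - delta <= sketch_prob s q (fun S : 'M[R]_(m, n) =>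
        opnorm (U1^T *m S^T *m S *m U1 - U1^T *m U1) <= 1 / 4%:R /\
        norm2 (U1^T *m (S^T *m S - 1%:M) *m (b - A *m xstar))
          <= Num.sqrt (eps * OPT / 2%:R)) &
      1 - delta <= sketch_prob s q (fun S : 'M[R]_(m, n) =>
        forall xt : 'cV[R]_d,
          argmin (sketched_objective S A b lambda L) xt ->
          objective A b lambda L xt <= (1 + eps) * OPT)].
Proof.
have /andP[delta0 _] := delta01.
(* (I) needs F1 <= 1/16, whose failure costs 16 * 2 sd^2 / m <= delta / 2 as soon as sd^2 / m <=
   delta / 64; (II) costs 4 sd / (eps m), which is smaller still. *)
exists (64 / delta); first by rewrite divr_gt0.
move=> n d p A b lambda L x U Ug V Q T sigma mu eps m s q U1 OPT sd.
move=> lambda0 rkL _ xmin Uorth Uspan gsvdAL eps0 q_sparse.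
rewrite mulrAC ler_pdivrMr // => m_large.
have OPT0 : 0 <= OPT := objective_ge0 L lambda0 _ _ _.
have sdE : fro2 U1 = sd.
  apply: (fro2_usubmx_stat_dim gsvdAL) => //.
  by rewrite -rkL rank_leq_col.
have sd0 : 0 <= sd by rewrite -sdE fro2_ge0.
pose r := b - A *m x.
pose c := eps * OPT / 2.
have c0 : 0 <= c by rewrite divr_ge0 // mulr_ge0 // ltW.
have r_OPT : fro2 r <= OPT.
  rewrite -norm2_sqr_fro2 norm2_sqr /r -opprB dotvNr dotvC dotvNr opprK.
  by rewrite -norm2_sqr lerDl mulr_ge0 // sqr_ge0.
pose F1 (S : 'M[R]_(m, n)) := fro2 (U1^T *m S^T *m S *m U1 - U1^T *m U1).
pose F2 (S : 'M[R]_(m, n)) := fro2 (U1^T *m S^T *m S *m r - U1^T *m r).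
have F2E S : fro2 (U1^T *m (S^T *m S - 1%:M) *m r) = F2 S.
  by rewrite /F2; move: (r) => v; rewrite mulmxBr mulmx1 mulmxBl !mulmxA.
have m_inv : 0 <= m%:R^-1 :> R by rewrite invr_ge0.
(* If [m = 0] then [m%:R^-1 = 0], so [m] need not be positive. *)
have bound_m y : 0 <= y -> y * 64 <= m%:R * delta -> y / m%:R <= delta / 64.
  move=> y0 y_m; have [->|m0] := posnP m; first by rewrite invr0 mulr0 divr_ge0 // ltW.
  by rewrite ler_pdivrMr ?ltr0n // mulrAC ler_pdivlMr // [delta * _]mulrC.
have eps_sd0 : 0 <= eps^-1 * sd by rewrite mulr_ge0 // invr_ge0 ltW.
have mean1 : sketch_mean s q F1 * 16 <= delta / 2.
  have := sketch_mean_mulmx q_sparse U1 U1.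
  have := bound_m (sd ^+ 2) (sqr_ge0 _); rewrite -/F1 sdE.
  set u := sketch_mean _ _ _; lra.
have mean2 : sketch_mean s q F2 / c <= delta / 2.
  have [->|cn0] := eqVneq c 0; first by rewrite invr0 mulr0 divr_ge0 // ltW.
  have cp : 0 < c by rewrite lt_def cn0.
  rewrite ler_pdivrMr //.
  apply: le_trans (sketch_mean_mulmx q_sparse U1 r) _.
  have h : sd / m%:R <= eps * (delta / 64).
    rewrite -ler_pdivrMl // mulrA; apply: bound_m => //.
    have := sqr_ge0 sd; lra.
  rewrite sdE mulrA.
  apply: (@le_trans _ _ (2 * (eps * (delta / 64)) * OPT)).
    apply: ler_pM => //; first by rewrite !mulr_ge0.
      exact: fro2_ge0.
    by rewrite -mulrA ler_pM2l // mulrC.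
  rewrite /c; have := mulr_ge0 (mulr_ge0 (ltW eps0) OPT0) (ltW delta0); lra.
have good : 1 - delta <= sketch_prob s q (fun S : 'M[R]_(m, n) =>
    opnorm (U1^T *m S^T *m S *m U1 - U1^T *m U1) <= 1 / 4%:R /\
    norm2 (U1^T *m (S^T *m S - 1%:M) *m r) <= Num.sqrt c).
  (* One application of Markov's inequality to the sum treats both properties jointly: if the sum is
     below 1, so is each nonnegative term. *)
  apply: (@le_trans _ _ (1 - sketch_mean s q (fun S => 16 * F1 S + c^-1 * F2 S))).
    rewrite sketch_meanD !sketch_meanZ; lra.
  apply: sketch_prob_markov => // S; first by rewrite addr_ge0 ?mulr_ge0 ?invr_ge0 ?fro2_ge0.
  move=> bad; rewrite leNgt; apply/negP => small; apply: bad.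
  have F10 : 0 <= F1 S := fro2_ge0 _.
  have F20 : 0 <= c^-1 * F2 S by rewrite mulr_ge0 ?invr_ge0 ?fro2_ge0.
  split.
    apply: le_trans (opnorm_le _) _; rewrite -/(F1 S).
    have -> : 1 / 4 = Num.sqrt ((1 / 4) ^+ 2) :> R by rewrite sqrtr_sqr ger0_norm // divr_ge0.
    rewrite ler_wsqrtr //; lra.
  rewrite norm2E ler_wsqrtr // -norm2_sqr norm2_sqr_fro2 F2E.
  (* If c = 0 then c^-1 = 0 and the Markov bound says nothing about F2; but then OPT = 0, the
     residual vanishes, and F2 = 0. *)
  have [c00|cn0] := eqVneq c 0.
    have : OPT = 0.
      by move/eqP: c00; rewrite !mulf_eq0 (gt_eqF eps0) invr_eq0 pnatr_eq0 orbF => /eqP.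
    move=> OPTe; have := r_OPT; rewrite OPTe c00 => r0.
    rewrite /F2 (fro2_le0 r0).
    by rewrite !mulmx0 subr0 /fro2 big1 // => i _; rewrite big1 // => j _; rewrite mxE expr0n.
  have : c^-1 * F2 S <= 1 by lra.
  by rewrite ler_pdivrMl ?mulr1 // lt_def cn0.
split=> //; first by move=> D g; apply: mul_cost_le.
apply: le_trans good (sketch_prob_le q_sparse _) => S [S1 S2] xt.
exact: (sketch_approx lambda0 (ltW eps0) Uorth Uspan xmin S1 S2).
Qed.
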